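(* Given a graph $G$ on $n$ vertices, the following are equivalent: (i) $G$ is in $1$-$HNG$ and $\omega(G)=2$; (ii) $G$ contains no $K_3$ and none of the graphs $F_1,\dots,F_{12}$ as an induced subgraph; (iii) $G$ is either (1) a (not necessarily induced) subgraph of $K_{2,n-2}$, (2) a (not necessarily induced) subgraph of $S_{m,n-m}$ for some $m$, or (3) a graph in the family $D_3$, possibly with the addition of isolated vertices.
   Context: All graphs are finite and simple. $\chi$ is the chromatic number, $\omega$ the clique number, and $\theta(G)=\chi(\overline{G})$ the clique cover number. A graph $G$ is in the class $1$-$HNG$ if every induced subgraph $H$ of $G$ (including $G$ itself) satisfies $\chi(H)+\theta(H)\ge |V(H)|$. $K_3$ is the triangle. The graphs $F_1,\dots,F_{12}$ are the 12 (up to isomorphism) bipartite graphs on exactly 6 vertices with matching number 3, i.e. that contain $3K_2$ (three disjoint edges) as a subgraph. $K_{k,l}$ is the complete bipartite graph with parts of sizes $k$ and $l$. $S_{m,n-m}$ is the double star on $n$ vertices: the tree with two adjacent center vertices of degrees $m$ and $n-m$, all other vertices being pendant (degree one) vertices attached to one of the centers. The family $D_3$ consists of all graphs obtained from a 5-cycle with vertices $c_1,c_2,c_3,c_4,c_5$ and edges $c_1c_2,c_2c_3,c_3c_4,c_4c_5,c_1c_5$ by adding a (possibly empty) stable set of new vertices, each of which has as its neighborhood one of the sets $\{c_1\}$, $\{c_1,c_3\}$, $\{c_1,c_4\}$ (any number of vertices of each type).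
   Formalization: The equivalence of (i) with (ii) is stated only for graphs with at least one edge, since edgeless graphs satisfy (ii) and (iii) but have clique number at most 1; (ii) iff (iii) is stated for all graphs, with n-2 read as 0 when n<2. *)

(* Defs.v *)
From mathcomp Require Import all_boot.

Set Implicit Arguments.
Unset Strict Implicit.
Unset Printing Implicit Defensive.

Record sgraph := SGraph {
  svertex :> finType;
  sedge : rel svertex;
  sedge_sym : symmetric sedge;
  sedge_irrefl : irreflexive sedge }.

Notation "x -- y" := (sedge x y) (at level 30).

Section Constructions.
Variable G : sgraph.

Definition compl_rel : rel G := fun x y => (x != y) && ~~ (x -- y).
Lemma compl_rel_sym : symmetric compl_rel.
Proof. by move=> x y; rewrite /compl_rel eq_sym sedge_sym. Qed.
Lemma compl_rel_irrefl : irreflexive compl_rel.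
Proof. by move=> x; rewrite /compl_rel eqxx. Qed.
Definition compl : sgraph := SGraph compl_rel_sym compl_rel_irrefl.

Variable S : {set G}.
Definition induced_rel : rel {x : G | x \in S} := fun x y => val x -- val y.
Lemma induced_rel_sym : symmetric induced_rel.
Proof. by move=> x y; rewrite /induced_rel sedge_sym. Qed.
Lemma induced_rel_irrefl : irreflexive induced_rel.
Proof. by move=> x; rewrite /induced_rel sedge_irrefl. Qed.
Definition induced : sgraph := SGraph induced_rel_sym induced_rel_irrefl.

End Constructions.

Definition is_subgraph (H G : sgraph) : Prop :=
  exists f : H -> G, injective f /\ forall x y : H, x -- y -> f x -- f y.

Definition is_induced_subgraph (H G : sgraph) : Prop :=
  exists f : H -> G, injective f /\ forall x y : H, f x -- f y = x -- y.

Section Invariants.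
Variable G : sgraph.

Definition colorable (k : nat) : bool :=
  [exists f : {ffun G -> 'I_k}, forall x, forall y, x -- y ==> (f x != f y)].

Lemma ex_colorable : exists k, colorable k.
Proof.
exists #|G|; apply/existsP; exists [ffun x => enum_rank x].
apply/forallP=> x; apply/forallP=> y; apply/implyP; apply: contraTneq.
by rewrite !ffunE => /enum_rank_inj ->; rewrite sedge_irrefl.
Qed.

Definition chi : nat := ex_minn ex_colorable.

Definition clique (K : {set G}) : bool :=
  [forall x in K, forall y in K, (x != y) ==> x -- y].

Definition stable (A : {set G}) : bool :=
  [forall x in A, forall y in A, ~~ (x -- y)].

Definition omega : nat := \max_(K : {set G} | clique K) #|K|.

Definition edges : {set {set G}} :=
  [set [set p.1; p.2] | p : G * G & p.1 -- p.2].

Definition matching (M : {set {set G}}) : bool :=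
  (M \subset edges) && trivIset M.

Definition matching_number : nat :=
  \max_(M : {set {set G}} | matching M) #|M|.

Definition bipartite : Prop :=
  exists A : {set G}, forall x y : G, x -- y -> (x \in A) != (y \in A).

Definition neighborhood (x : G) : {set G} := [set y | x -- y].

Definition isolated (x : G) : Prop := neighborhood x = set0.

End Invariants.

Definition theta (G : sgraph) : nat := chi (compl G).

Definition HNG1 (G : sgraph) : Prop :=
  forall S : {set G}, #|induced S| <= chi (induced S) + theta (induced S).

Definition complete_rel (k : nat) : rel 'I_k := fun i j => i != j.
Lemma complete_rel_sym k : symmetric (@complete_rel k).
Proof. by move=> i j; rewrite /complete_rel eq_sym. Qed.
Lemma complete_rel_irrefl k : irreflexive (@complete_rel k).
Proof. by move=> i; rewrite /complete_rel eqxx. Qed.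
Definition complete (k : nat) : sgraph :=
  SGraph (@complete_rel_sym k) (@complete_rel_irrefl k).

(* The graphs isomorphic to one of F_1, ..., F_12. *)
Definition is_F (H : sgraph) : Prop :=
  [/\ #|H| = 6, bipartite H & matching_number H = 3].

Definition K3_F_free (G : sgraph) : Prop :=
  ~ is_induced_subgraph (complete 3) G /\
  forall H : sgraph, is_F H -> ~ is_induced_subgraph H G.

Definition complete_bipartite_rel (k l : nat) : rel ('I_k + 'I_l) :=
  fun x y => match x, y with
             | inl _, inr _ | inr _, inl _ => true
             | _, _ => false
             end.
Lemma complete_bipartite_rel_sym k l : symmetric (@complete_bipartite_rel k l).
Proof. by case=> i [j|j]. Qed.
Lemma complete_bipartite_rel_irrefl k l :
  irreflexive (@complete_bipartite_rel k l).
Proof. by case. Qed.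
Definition complete_bipartite (k l : nat) : sgraph :=
  SGraph (@complete_bipartite_rel_sym k l) (@complete_bipartite_rel_irrefl k l).

(* The centers inl None and inr None have degrees a and b when 0 < a and
   0 < b: each is adjacent to the other center and to its own pendant
   vertices, a.-1 vertices inl (Some _) and b.-1 vertices inr (Some _). *)
Definition double_star_rel (a b : nat) :
    rel (option 'I_a.-1 + option 'I_b.-1) :=
  fun x y => match x, y with
             | inl None, inr None | inr None, inl None => true
             | inl None, inl (Some _) | inl (Some _), inl None => true
             | inr None, inr (Some _) | inr (Some _), inr None => true
             | _, _ => false
             end.
Lemma double_star_rel_sym a b : symmetric (@double_star_rel a b).
Proof. by case=> [[i|]|[i|]] [[j|]|[j|]]. Qed.
Lemma double_star_rel_irrefl a b : irreflexive (@double_star_rel a b).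
Proof. by case=> [[i|]|[i|]]. Qed.
Definition double_star (a b : nat) : sgraph :=
  SGraph (@double_star_rel_sym a b) (@double_star_rel_irrefl a b).

Definition in_D3 (H : sgraph) : Prop :=
  exists c1 c2 c3 c4 c5 : H,
    let C := [set c1; c2; c3; c4; c5] in
    let cyc := [:: (c1, c2); (c2, c3); (c3, c4); (c4, c5); (c1, c5)] in
    [/\ uniq [:: c1; c2; c3; c4; c5],
        {in C &, forall x y, x -- y = ((x, y) \in cyc) || ((y, x) \in cyc)},
        stable (~: C)
      & {in ~: C, forall v, neighborhood v \in
                    [:: [set c1]; [set c1; c3]; [set c1; c4]]}].

Definition in_D3_plus_isolated (G : sgraph) : Prop :=
  exists S : {set G},
    in_D3 (induced S) /\ forall x : G, x \notin S -> isolated x.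

(* Main.v *)
Require Import Defs.
From mathcomp Require Import all_boot.

Set Implicit Arguments.
Unset Strict Implicit.
Unset Printing Implicit Defensive.

(* A graph is triangle-free and has no induced F_i iff it has no triangle and
   no "F-configuration": two stable triples joined by a perfect matching. If
   such a graph has no 5-cycle, then three disjoint edges would span a bipartite
   graph, so the matching number is at most 2, and two vertices cover all edges:
   this gives (1) or (2) according as these vertices are adjacent or not. If it
   has a 5-cycle C, the vertices outside C form a stable set, and their nonempty
   neighbourhoods in C pairwise intersect, which yields (3). Finally, the
   complement of a vertex cover T is stable, so theta >= n - |T|; a cover of
   size 2 when there is an edge (chi >= 2), or of size 3 when there is a 5-cycle
   (chi >= 3), gives chi + theta >= n. *)

(** * Forbidden configurations, 5-cycles and vertex covers *)

Definition triangle_free (G : sgraph) : Prop :=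
  forall x y z : G, x -- y -> y -- z -> x -- z -> False.

(** The pairs [xi], [yj] with i and j different are left free, so this one predicate covers all
    twelve graphs F_i. That the six vertices are distinct is derived in [F_config_uniq]. *)
Definition F_config (G : sgraph) (x1 x2 x3 y1 y2 y3 : G) : bool :=
  [&& uniq [:: x1; x2; x3], uniq [:: y1; y2; y3],
      x1 -- y1, x2 -- y2, x3 -- y3,
      ~~ x1 -- x2, ~~ x1 -- x3, ~~ x2 -- x3,
      ~~ y1 -- y2, ~~ y1 -- y3 & ~~ y2 -- y3].

Definition F_config_free (G : sgraph) : Prop :=
  forall x1 x2 x3 y1 y2 y3 : G, F_config x1 x2 x3 y1 y2 y3 -> False.

(** Literally a closed walk of length 5; in a triangle-free graph it is an induced 5-cycle, by
    [cycle5_uniq] and [cycle5_chord]. *)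
Definition cycle5 (G : sgraph) (a b c d e : G) : bool :=
  [&& a -- b, b -- c, c -- d, d -- e & e -- a].

Definition covers (G : sgraph) (T : {set G}) : Prop :=
  forall x y : G, x -- y -> (x \in T) || (y \in T).

Ltac split_uniq U :=
  rewrite /= ?inE ?negb_or ?andbT -?andbA in U;
  repeat (let H := fresh "neq" in case/andP: U => H U).

Ltac by_conj :=
  rewrite /F_config /cycle5 /= ?inE ?negb_or ?andbT -?andbA;
  repeat (apply/andP; split);
  first [done | by rewrite eq_sym | by rewrite sedge_sym].

Lemma sedge_neq (G : sgraph) (x y : G) : x -- y -> x != y.
Proof. by apply: contraTneq => ->; rewrite sedge_irrefl. Qed.

Lemma triangle_freeN (G : sgraph) (x y z : G) : triangle_free G ->
  x -- y -> y -- z -> ~~ x -- z.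
Proof. by move=> tf xy yz; apply/negP; apply: tf xy yz. Qed.

(** An edge [xz] or [yw] turns each of [xw] and [yz] into the third side of a triangle. So two edges
    can always be aligned with no edge between equal sides. *)
Lemma edge_pair_orient (G : sgraph) (x y z w : G) : triangle_free G ->
    x -- y -> z -- w ->
  (~~ x -- z /\ ~~ y -- w) \/ (~~ x -- w /\ ~~ y -- z).
Proof.
move=> tf xy zw.
have [xz|] := boolP (x -- z).
  right; split; first exact: triangle_freeN xz zw.
  by apply: triangle_freeN (xz) => //; rewrite sedge_sym.
have [yw|] := boolP (y -- w); last by left.
right; split; first exact: triangle_freeN xy yw.
by apply: triangle_freeN (yw) _ => //; rewrite sedge_sym.
Qed.

(** * Graphs without a 5-cycle have a vertex cover of size at most 2 *)

Section NoFiveCycle.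
Variable G : sgraph.
Hypotheses (tf : triangle_free G) (Ff : F_config_free G).
Hypothesis no5 : forall a b c d e : G, ~~ cycle5 a b c d e.

(** Edge 1 is aligned with edges 2 and 3, but [x2 -- x3] joins equal sides. Exchanging the ends of
    edge 2 or of edge 3 yields an F-configuration, unless cross edges at [x1] or [y1] prevent it;
    these close up to a 5-cycle through [x2 -- x3] or to a triangle. *)
Let three_edges_twisted (x1 y1 x2 y2 x3 y3 : G) :
    uniq [:: x1; y1; x2; y2; x3; y3] -> x1 -- y1 -> x2 -- y2 -> x3 -- y3 ->
    ~~ x1 -- x2 -> ~~ y1 -- y2 -> ~~ x1 -- x3 -> ~~ y1 -- y3 ->
  x2 -- x3 -> False.
Proof.
move=> U e1 e2 e3 n12 m12 n13 m13 x23; split_uniq U.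
have x32 : x3 -- x2 by rewrite sedge_sym.
have nx2y3 : ~~ x2 -- y3 by exact: triangle_freeN x23 e3.
have nx3y2 : ~~ x3 -- y2 by exact: triangle_freeN x32 e2.
have [x1y2|nx1y2] := boolP (x1 -- y2); have [x1y3|nx1y3] := boolP (x1 -- y3).
- by case/negP: (no5 x1 y2 x2 x3 y3); by_conj.
- have [y1x3|ny1x3] := boolP (y1 -- x3).
    by case/negP: (no5 x1 y2 x2 x3 y1); by_conj.
  by apply: (@Ff x1 x2 y3 y1 y2 x3); by_conj.
- have [y1x2|ny1x2] := boolP (y1 -- x2).
    by case/negP: (no5 x1 y3 x3 x2 y1); by_conj.
  by apply: (@Ff x1 y2 x3 y1 x2 y3); by_conj.
have [y1x2|ny1x2] := boolP (y1 -- x2); last first.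
  by apply: (@Ff x1 y2 x3 y1 x2 y3); by_conj.
have [y1x3|ny1x3] := boolP (y1 -- x3); first exact: tf y1x2 x23 y1x3.
by apply: (@Ff x1 x2 y3 y1 y2 x3); by_conj.
Qed.

(** If neither [x2 -- x3] nor [y2 -- y3], the edges form an F-configuration. Each of these two edges
    gives the twisted case, the second one after exchanging the sides. *)
Let three_edges_straight (x1 y1 x2 y2 x3 y3 : G) :
    uniq [:: x1; y1; x2; y2; x3; y3] -> x1 -- y1 -> x2 -- y2 -> x3 -- y3 ->
    ~~ x1 -- x2 -> ~~ y1 -- y2 -> ~~ x1 -- x3 -> ~~ y1 -- y3 ->
  False.
Proof.
move=> U e1 e2 e3 n12 m12 n13 m13.
have [x23|x23] := boolP (x2 -- x3); 
  first by apply: (@three_edges_twisted x1 y1 x2 y2 x3 y3).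
split_uniq U.
have [y23|y23] := boolP (y2 -- y3).
  by apply: (@three_edges_twisted y1 x1 y2 x2 y3 x3) => //; by_conj.
by apply: (@Ff x1 x2 x3 y1 y2 y3); by_conj.
Qed.

(* Edges between two of the three edges force one way of aligning them; three
   incompatible alignments would close up to a 5-cycle. *)
Lemma no_three_disjoint_edges (x1 y1 x2 y2 x3 y3 : G) :
    uniq [:: x1; y1; x2; y2; x3; y3] -> x1 -- y1 -> x2 -- y2 -> x3 -- y3 ->
  False.
Proof.
move=> U e1 e2 e3; split_uniq U.
have [[]|[]] := edge_pair_orient tf e1 e2 => n12 m12;
  have [[]|[]] := edge_pair_orient tf e1 e3 => n13 m13.
- by apply: (@three_edges_straight x1 y1 x2 y2 x3 y3) => //; by_conj.
- by apply: (@three_edges_straight x1 y1 x2 y2 y3 x3) => //; by_conj.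
- by apply: (@three_edges_straight x1 y1 y2 x2 x3 y3) => //; by_conj.
- by apply: (@three_edges_straight x1 y1 y2 x2 y3 x3) => //; by_conj.
Qed.

(** By [cov] the edges [ab] and [cd] form a maximal matching, and [b], [d] have no neighbours off
    its four vertices. The cover consists of one end of each edge. *)
Let cover2_aux (a b c d : G) :
    uniq [:: a; b; c; d] -> a -- b -> c -- d ->
    (forall u v : G, u -- v -> u \notin [:: a; b; c; d] ->
       v \in [:: a; b; c; d]) ->
    (forall v : G, b -- v -> v \in [:: a; b; c; d]) ->
    (forall v : G, d -- v -> v \in [:: a; b; c; d]) ->
  exists T : {set G}, #|T| <= 2 /\ covers T.
Proof.
move=> U ab cd cov nb nd; split_uniq U.
have card2 (x y : G) : #|[set x; y]| <= 2 by rewrite cards2; case: (x != y).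
have coverI (x y : G) :
    (forall u v, u -- v -> u \notin [:: x; y] -> v \in [:: x; y]) ->
  exists T : {set G}, #|T| <= 2 /\ covers T.
  move=> H; exists [set x; y]; split => // u v /H.
  by rewrite !inE; case: (_ || _) => //= ->.
have ba : b -- a by rewrite sedge_sym.
have out_ac u v : u -- v -> u \notin [:: a; b; c; d] -> v \in [:: a; c].
  move=> uv uN; move: (cov u v uv uN) (uv) (uN); rewrite !inE.
  case/or4P=> /eqP->; rewrite ?eqxx ?orbT // sedge_sym.
    by move=> /nb; rewrite !inE => ->.
  by move=> /nd; rewrite !inE => ->.
(* Without the edge [bd], every edge at [b] or [d] ends in [a] or [c], so these two cover. *)
have [bd|nbd] := boolP (b -- d); last first.
  apply: (coverI a c) => u v uv uN.
  have [|uN'] := boolP (u \in [:: a; b; c; d]); last exact: out_ac uv uN'.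
  move=> uI; move: uN uI (uv); rewrite !inE.
  case/norP=> /negbTE-> /negbTE-> /= /orP[]/eqP->.
    move=> bv; move: (nb v bv) (bv); rewrite !inE.
    case/or4P=> /eqP->; rewrite ?eqxx ?orbT ?sedge_irrefl //.
    by rewrite (negbTE nbd).
  move=> dv; move: (nd v dv) (dv); rewrite !inE.
  case/or4P=> /eqP->; rewrite ?eqxx ?orbT ?sedge_irrefl //.
  by rewrite sedge_sym (negbTE nbd).
have dc : d -- c by rewrite sedge_sym.
have nbc : ~~ b -- c by apply: triangle_freeN bd dc.
have nad : ~~ a -- d by apply: triangle_freeN ab bd.
(* Now a, b, d, c is a path. If [a] has a neighbour [r] off it, then [c] has none: [r] itself would
   close a 5-cycle, and any other [v] would give the disjoint edges [ra], [bd], [cv]. Hence [a] and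
   [d] cover. If [a] has no such neighbour, [b] and [c] cover. *)
have [/existsP[r /andP[ar rN]]|] :=
  boolP [exists r, a -- r && (r \notin [:: a; b; c; d])].
  have cN v : c -- v -> v \in [:: a; b; c; d].
    move=> cv; apply: contraT => vN.
    have [vr|vr] := eqVneq v r.
      by subst v; case/negP: (no5 r a b d c); by_conj.
    case: (@no_three_disjoint_edges r a b d c v) => //;
      last by rewrite sedge_sym.
    split_uniq rN; split_uniq vN; by_conj.
  apply: (coverI a d) => u v uv uN.
  have [|uN'] := boolP (u \in [:: a; b; c; d]); last first.
    move: (out_ac u v uv uN') (uv); rewrite !inE => /orP[]/eqP->.
      by rewrite eqxx.
    by rewrite sedge_sym => /cN; rewrite (negbTE uN').
  move=> uI; move: uN uI (uv); rewrite !inE => /norP[/negbTE-> /negbTE->] /=.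
  rewrite orbF => /orP[]/eqP->.
    move=> bv; move: (nb v bv) (bv); rewrite !inE.
    case/or4P=> /eqP->; rewrite ?eqxx ?orbT ?sedge_irrefl //.
    by rewrite (negbTE nbc).
  move=> cv; move: (cN v cv) (cv); rewrite !inE.
  case/or4P=> /eqP->; rewrite ?eqxx ?orbT ?sedge_irrefl //.
  by rewrite sedge_sym (negbTE nbc).
rewrite negb_exists => /forallP aN.
have na v : a -- v -> v \in [:: a; b; c; d].
  by move=> av; move: (aN v); rewrite av negbK.
apply: (coverI b c) => u v uv uN.
have [|uN'] := boolP (u \in [:: a; b; c; d]); last first.
  move: (out_ac u v uv uN') (uv); rewrite !inE => /orP[]/eqP->.
    by rewrite sedge_sym => /na; rewrite (negbTE uN').
  by rewrite eqxx orbT.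
move=> uI; move: uN uI (uv); rewrite !inE.
  case/norP=> /negbTE-> /negbTE-> /= /orP[]/eqP->.
  move=> av; move: (na v av) (av); rewrite !inE.
  case/or4P=> /eqP->; rewrite ?eqxx ?orbT ?sedge_irrefl //.
  by rewrite (negbTE nad).
move=> dv; move: (nd v dv) (dv); rewrite !inE.
case/or4P=> /eqP->; rewrite ?eqxx ?orbT ?sedge_irrefl //.
by rewrite sedge_sym (negbTE nad).
Qed.

Lemma small_cover : exists T : {set G}, #|T| <= 2 /\ covers T.
Proof.
have [/existsP[a /existsP[b ab]]|] :=
  boolP [exists a : G, exists b : G, a -- b]; last first.
  rewrite negb_exists => /forallP nE.
  exists set0; rewrite cards0; split=> // x y xy.
  by move: (nE x); rewrite negb_exists => /forallP/(_ y); rewrite xy.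
have ba : b -- a by rewrite sedge_sym.
have nab := sedge_neq ab.
have [/existsP[c /existsP[d /and3P[cd cN dN]]]|] :=
  boolP [exists c : G, exists d : G,
    [&& c -- d, c \notin [:: a; b] & d \notin [:: a; b]]]; last first.
  rewrite negb_exists => /forallP nE.
  exists [set a; b]; rewrite cards2 nab; split=> // x y xy.
  move: (nE x); rewrite negb_exists => /forallP/(_ y); rewrite xy /= !inE.
  by rewrite negb_and !negbK.
have dc : d -- c by rewrite sedge_sym.
have ncd := sedge_neq cd.
split_uniq cN; split_uniq dN.
have cov u v : u -- v -> u \notin [:: a; b; c; d] -> v \in [:: a; b; c; d].
  move=> uv uN; apply: contraT => vN; have nuv := sedge_neq uv.
  case: (@no_three_disjoint_edges a b c d u v) => //.
  by split_uniq uN; split_uniq vN; by_conj.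
(* Outside neighbours [r] of [x] and [v] of [y] would augment the matching to [rx], [yv], [zw], or
   form a triangle when they coincide. So each matching edge has an end without outside neighbours,
   and relabelling makes these ends the [b] and [d] of [cover2_aux]. *)
have one_out (x y z w : G) : uniq [:: x; y; z; w] -> x -- y -> z -- w ->
    (forall v, x -- v -> v \in [:: x; y; z; w]) \/
    (forall v, y -- v -> v \in [:: x; y; z; w]).
  move=> U xy zw.
  have [/existsP[r /andP[xr rN]]|] :=
    boolP [exists r, x -- r && (r \notin [:: x; y; z; w])]; last first.
    rewrite negb_exists => /forallP xN; left=> v xv.
    by move: (xN v); rewrite xv negbK.
  right=> v yv; apply: contraT => vN.
  have [vr|nvr] := eqVneq v r; first by subst v; case: (tf xy yv xr).
  case: (@no_three_disjoint_edges r x y v z w) => //; last by rewrite sedge_sym.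
  by split_uniq U; split_uniq rN; split_uniq vN; by_conj.
have E1 v : (v \in [:: b; a; c; d]) = (v \in [:: a; b; c; d]).
  by rewrite !inE orbCA.
have E2 v : (v \in [:: a; b; d; c]) = (v \in [:: a; b; c; d]).
  by rewrite !inE [(v == d) || _]orbC.
have E3 v : (v \in [:: b; a; d; c]) = (v \in [:: a; b; c; d]).
  by rewrite -E2 !inE orbCA.
have E4 v : (v \in [:: c; d; a; b]) = (v \in [:: a; b; c; d]).
  by rewrite !inE orbA orbC -orbA.
have aux (x y z w : G) : [:: x; y; z; w] =i [:: a; b; c; d] ->
    x -- y -> z -- w ->
    (forall v, y -- v -> v \in [:: a; b; c; d]) ->
    (forall v, w -- v -> v \in [:: a; b; c; d]) ->
  exists T : {set G}, #|T| <= 2 /\ covers T.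
  move=> E xy zw ny nw; apply: (@cover2_aux x y z w) => // [|u v|v|v].
  - by rewrite (eq_uniq _ E) //; by_conj.
  - by rewrite !E; apply: cov.
  - by rewrite E; apply: ny.
  - by rewrite E; apply: nw.
have abE v : v \in [:: c; d; a; b] -> v \in [:: a; b; c; d] by rewrite E4.
have Uab : uniq [:: a; b; c; d] by by_conj.
have Ucd : uniq [:: c; d; a; b] by by_conj.
have [na|nb] := one_out _ _ _ _ Uab ab cd;
  have [nc|nd] := one_out _ _ _ _ Ucd cd ab.
- exact: (aux b a d c E3 ba dc na (fun v h => abE _ (nc v h))).
- exact: (aux b a c d E1 ba cd na (fun v h => abE _ (nd v h))).
- exact: (aux a b d c E2 ab dc nb (fun v h => abE _ (nc v h))).
- exact: (aux a b c d (fun=> erefl) ab cd nb (fun v h => abE _ (nd v h))).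
Qed.
End NoFiveCycle.

(** * How the other vertices attach to a 5-cycle *)

Section FiveCycle.
Variable G : sgraph.
Hypotheses (tf : triangle_free G) (Ff : F_config_free G).
Implicit Types a b c d e u v x y z : G.

Lemma cycle5_rot a b c d e : cycle5 a b c d e -> cycle5 b c d e a.
Proof. by case/and5P=> *; apply/and5P; split. Qed.

Lemma cycle5_rev a b c d e : cycle5 a b c d e -> cycle5 a e d c b.
Proof. by case/and5P=> *; by_conj. Qed.

Lemma cycle5_chord a b c d e : cycle5 a b c d e -> ~~ a -- c.
Proof. by case/and5P=> ab bc _ _ _; apply: triangle_freeN ab bc. Qed.

(** If two vertices at distance 2 on the walk coincide, the longer way round between them is a
    triangle. *)
Lemma cycle5_uniq a b c d e : cycle5 a b c d e -> uniq [:: a; b; c; d; e].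
Proof.
have neq2 x y z t w : cycle5 x y z t w -> x != z.
  case/and5P=> _ _ zt tw wx; apply: contraT; rewrite negbK => /eqP xz.
  by subst z; case: (tf zt tw); rewrite sedge_sym.
move=> C; have C1 := cycle5_rot C; have C2 := cycle5_rot C1.
have C3 := cycle5_rot C2; have C4 := cycle5_rot C3.
move: (neq2 _ _ _ _ _ C) (neq2 _ _ _ _ _ C1) (neq2 _ _ _ _ _ C2).
move: (neq2 _ _ _ _ _ C3) (neq2 _ _ _ _ _ C4) => n1 n2 n3 n4 n5.
case/and5P: C => /sedge_neq ? /sedge_neq ? /sedge_neq ? /sedge_neq ?.
move=> /sedge_neq ?.
by by_conj.
Qed.

Let nbr2 u a b : a -- b -> ~~ (u -- a && u -- b).
Proof. by move=> ab; apply/negP => /andP[ua]; apply: tf ua ab. Qed.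

(** An edge off the cycle, together with two disjoint edges of the cycle, forms an F-configuration
    for at least one of the five rotations, since triangle-freeness leaves few possible
    neighbourhoods for [u] and [v]. *)
Lemma cycle5_edge a b c d e u v : cycle5 a b c d e ->
    u -- v -> (u \in [:: a; b; c; d; e]) || (v \in [:: a; b; c; d; e]).
Proof.
move=> C uv; apply: contraT; rewrite negb_or => /andP[uC vC].
have nuv := sedge_neq uv.
(* The F-configurations excluded here have the matching edges [xy], [zt], [uv], with [u] on the side
   of [y], [t] or on the side of [x], [z]. *)
have clause x y z t w : cycle5 x y z t w ->
    u \notin [:: x; y; z; t; w] -> v \notin [:: x; y; z; t; w] ->
  ~~ [&& ~~ u -- x, ~~ u -- z, ~~ v -- y & ~~ v -- t]
  && ~~ [&& ~~ v -- x, ~~ v -- z, ~~ u -- y & ~~ u -- t].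
  move=> D uD vD; have U := cycle5_uniq D.
  have D1 := cycle5_rot D; have nxz := cycle5_chord D.
  have nyt := cycle5_chord D1; case/and5P: D => xy _ zt _ _.
  split_uniq U; split_uniq uD; split_uniq vD.
  apply/andP; split; apply/negP => /and4P[? ? ? ?].
    by apply: (@Ff x z u y t v); by_conj.
  by apply: (@Ff x z v y t u); by_conj.
have clause_rot x y z t w : cycle5 x y z t w ->
    u \notin [:: x; y; z; t; w] -> v \notin [:: x; y; z; t; w] ->
  u \notin [:: y; z; t; w; x] /\ v \notin [:: y; z; t; w; x].
  by move=> _ uD vD; split_uniq uD; split_uniq vD; split; by_conj.
have C1 := cycle5_rot C; have C2 := cycle5_rot C1.
have C3 := cycle5_rot C2; have C4 := cycle5_rot C3.
have [uC1 vC1] := clause_rot _ _ _ _ _ C uC vC.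
have [uC2 vC2] := clause_rot _ _ _ _ _ C1 uC1 vC1.
have [uC3 vC3] := clause_rot _ _ _ _ _ C2 uC2 vC2.
have [uC4 vC4] := clause_rot _ _ _ _ _ C3 uC3 vC3.
have common x : ~~ (u -- x && v -- x).
  by apply/negP=> /andP[ux vx]; case: (tf uv vx ux).
case/and5P: (C) => ab bc cd de ea.
move: (clause _ _ _ _ _ C uC vC) (clause _ _ _ _ _ C1 uC1 vC1).
move: (clause _ _ _ _ _ C2 uC2 vC2) (clause _ _ _ _ _ C3 uC3 vC3).
move: (clause _ _ _ _ _ C4 uC4 vC4).
move: (common a) (common b) (common c) (common d) (common e).
move: (nbr2 u ab) (nbr2 u bc) (nbr2 u cd) (nbr2 u de) (nbr2 u ea).
move: (nbr2 v ab) (nbr2 v bc) (nbr2 v cd) (nbr2 v de) (nbr2 v ea).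
(* What remains is propositional in the ten adjacencies of [u] and [v] to the cycle. *)
case: (u -- a); case: (u -- b); case: (u -- c); case: (u -- d);
  case: (u -- e) => //=;
case: (v -- a); case: (v -- b); case: (v -- c); case: (v -- d);
  by case: (v -- e).
Qed.

(** The neighbours [x'] and [y'] lie on the cycle by [cycle5_edge]. If the two neighbourhoods were
    disjoint, some four consecutive cycle vertices p, q, r, s would form an F-configuration with [x]
    and [y], one added to p, r and the other to q, s. *)
Lemma cycle5_common_nbr a b c d e x y x' y' : cycle5 a b c d e ->
    x \notin [:: a; b; c; d; e] -> y \notin [:: a; b; c; d; e] ->
    x -- x' -> y -- y' ->
  has (fun z => x -- z && y -- z) [:: a; b; c; d; e].
Proof.
move=> C xC yC xx' yy'.
have x'C : x' \in [:: a; b; c; d; e].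
  by have := cycle5_edge C xx'; rewrite (negbTE xC).
have y'C : y' \in [:: a; b; c; d; e].
  by have := cycle5_edge C yy'; rewrite (negbTE yC).
have [exy|nxy] := eqVneq x y.
  by apply/hasP; exists x' => //; rewrite -exy xx'.
have nexy : ~~ x -- y.
  by apply/negP=> /(cycle5_edge C); rewrite (negbTE xC) (negbTE yC).
have clause u v p q r s t : cycle5 p q r s t -> u != v -> ~~ u -- v ->
    u \notin [:: p; q; r; s; t] -> v \notin [:: p; q; r; s; t] ->
  ~~ [&& ~~ u -- q, ~~ u -- s, ~~ v -- p, ~~ v -- r
       & u -- p && (v -- q || v -- s) || u -- r && v -- s].
  move=> D nuv neuv uD vD; have U := cycle5_uniq D.
  have D1 := cycle5_rot D; have npr := cycle5_chord D.
  have nqs := cycle5_chord D1; case/and5P: D => pq qr rs _ _.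
  split_uniq U; split_uniq uD; split_uniq vD.
  apply/negP => /and5P[? ? ? ? /orP[/andP[up /orP[vq|vs]]|/andP[ur vs]]].
  - by apply: (@Ff p v r u q s); by_conj.
  - by apply: (@Ff p r v u q s); by_conj.
  - by apply: (@Ff p r v q u s); by_conj.
have rot p q r s t u : u \notin [:: p; q; r; s; t] ->
  u \notin [:: q; r; s; t; p] by move=> uD; split_uniq uD; by_conj.
have neyx : ~~ y -- x by rewrite sedge_sym.
have nyx : y != x by rewrite eq_sym.
have C1 := cycle5_rot C; have C2 := cycle5_rot C1.
have C3 := cycle5_rot C2; have C4 := cycle5_rot C3.
have xC1 := rot _ _ _ _ _ _ xC; have yC1 := rot _ _ _ _ _ _ yC.
have xC2 := rot _ _ _ _ _ _ xC1; have yC2 := rot _ _ _ _ _ _ yC1.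
have xC3 := rot _ _ _ _ _ _ xC2; have yC3 := rot _ _ _ _ _ _ yC2.
have xC4 := rot _ _ _ _ _ _ xC3; have yC4 := rot _ _ _ _ _ _ yC3.
have hx : has (sedge x) [:: a; b; c; d; e] by apply/hasP; exists x'.
have hy : has (sedge y) [:: a; b; c; d; e] by apply/hasP; exists y'.
case/and5P: (C) => ab bc cd de ea.
move: (clause _ _ _ _ _ _ _ C nxy nexy xC yC).
move: (clause _ _ _ _ _ _ _ C nyx neyx yC xC).
move: (clause _ _ _ _ _ _ _ C1 nxy nexy xC1 yC1).
move: (clause _ _ _ _ _ _ _ C1 nyx neyx yC1 xC1).
move: (clause _ _ _ _ _ _ _ C2 nxy nexy xC2 yC2).
move: (clause _ _ _ _ _ _ _ C2 nyx neyx yC2 xC2).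
move: (clause _ _ _ _ _ _ _ C3 nxy nexy xC3 yC3).
move: (clause _ _ _ _ _ _ _ C3 nyx neyx yC3 xC3).
move: (clause _ _ _ _ _ _ _ C4 nxy nexy xC4 yC4).
move: (clause _ _ _ _ _ _ _ C4 nyx neyx yC4 xC4).
move: (nbr2 x ab) (nbr2 x bc) (nbr2 x cd) (nbr2 x de) (nbr2 x ea).
move: (nbr2 y ab) (nbr2 y bc) (nbr2 y cd) (nbr2 y de) (nbr2 y ea).
move: hx hy => /=.
case: (x -- a); case: (x -- b); case: (x -- c); case: (x -- d);
  case: (x -- e) => //=;
case: (y -- a); case: (y -- b); case: (y -- c); case: (y -- d);
  by case: (y -- e).
Qed.
End FiveCycle.

(** The vertex [a] plays the role of c_1 in D_3; the edge [v -- u] expresses that [v] is not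
    isolated. *)
Definition centered_cycle5 (G : sgraph) (a b c d e : G) : Prop :=
  cycle5 a b c d e /\
  forall v u : G, v \notin [:: a; b; c; d; e] -> v -- u -> v -- a.

(** * Existence of a common neighbour on the 5-cycle *)

Section FiveCycle.
Variable G : sgraph.
Hypotheses (tf : triangle_free G) (Ff : F_config_free G).
Implicit Types a b c d e u v x y z : G.

Let nbr2 u a b : a -- b -> u -- a -> u -- b -> False.
Proof. by move=> ab ua; apply: tf ua ab. Qed.

(* The neighbourhoods on the 5-cycle pairwise intersect and are edges or
   vertices of the complementary 5-cycle, which has no triangle: hence they
   share a vertex. *)
Let center_third a b c d e x y : cycle5 a b c d e ->
    x \notin [:: a; b; c; d; e] -> y \notin [:: a; b; c; d; e] ->
    x -- a -> x -- c -> y -- c -> ~~ y -- a ->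
  centered_cycle5 c d e a b.
Proof.
move=> C xC yC xa xc yc nya.
split=> [|v u vC vu]; first exact: cycle5_rot (cycle5_rot C).
have {}vC : v \notin [:: a; b; c; d; e] by split_uniq vC; by_conj.
case/and5P: (C) => ab bc cd de ea.
apply: contraT => nvc.
have va : v -- a.
  have /hasP[z zC /andP[xz vz]] := cycle5_common_nbr tf Ff C xC vC xa vu.
  move: zC xz vz; rewrite !inE => /or4P[/eqP->|/eqP->|/eqP->|/orP[]/eqP->] //.
  - by move=> /(nbr2 ab xa).
  - by rewrite (negbTE nvc).
  - by move=> /(nbr2 cd xc).
  - by move=> xe; case: (nbr2 ea xe xa).
have /hasP[z zC /andP[yz vz]] := cycle5_common_nbr tf Ff C yC vC yc vu.
move: zC yz vz; rewrite !inE => /or4P[/eqP->|/eqP->|/eqP->|/orP[]/eqP->].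
- by rewrite (negbTE nya).
- by move=> yb; case: (nbr2 bc yb yc).
- by rewrite (negbTE nvc).
- by move=> /(nbr2 cd yc).
- by move=> _ ve; case: (nbr2 ea ve va).
Qed.

(** If [a] is not a centre, some non-isolated [y] off the cycle misses it. A cycle vertex shared by
    [x] and [y] is then neither [a] nor, by triangle-freeness at [x], one of [b], [e]. So it is [c]
    or its mirror image [d], and [center_third] applies. *)
Let center_nbr a b c d e x : cycle5 a b c d e ->
    x \notin [:: a; b; c; d; e] -> x -- a ->
  exists a' b' c' d' e', centered_cycle5 a' b' c' d' e'.
Proof.
move=> C xC xa; case/and5P: (C) => ab bc cd de ea.
have [/forallP H|] := boolP [forall v,
    (v \notin [:: a; b; c; d; e]) && [exists u, v -- u] ==> (v -- a)].
  exists a, b, c, d, e; split=> // v u vC vu.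
  by apply: (implyP (H v)); rewrite vC; apply/existsP; exists u.
rewrite negb_forall => /existsP[y].
rewrite negb_imply => /andP[/andP[yC /existsP[u yu]] nya].
have /hasP[z zC /andP[xz yz]] := cycle5_common_nbr tf Ff C xC yC xa yu.
move: zC xz yz; rewrite !inE => /or4P[/eqP->|/eqP->|/eqP->|/orP[]/eqP->].
- by rewrite (negbTE nya).
- by move=> /(nbr2 ab xa).
- move=> xc yc; exists c, d, e, a, b.
  by apply: (@center_third a b c d e x y).
- move=> xd yd; exists d, c, b, a, e.
  apply: (@center_third a e d c b x y) => //; first exact: cycle5_rev.
    by split_uniq xC; by_conj.
  by split_uniq yC; by_conj.
- by move=> xe; case: (nbr2 ea xe xa).
Qed.

Lemma cycle5_centered a b c d e : cycle5 a b c d e ->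
  exists a' b' c' d' e' : G, centered_cycle5 a' b' c' d' e'.
Proof.
move=> C.
have [/existsP[x /andP[xC /existsP[u xu]]]|] := boolP [exists x,
    (x \notin [:: a; b; c; d; e]) && [exists u, x -- u]]; last first.
  (* Here every vertex off the cycle is isolated and the condition on the centre is vacuous. *)
  rewrite negb_exists => /forallP H; exists a, b, c, d, e; split=> // v u vC vu.
  by move: (H v); rewrite vC /= negb_exists => /forallP/(_ u); rewrite vu.
have rot p q r s t : x \notin [:: p; q; r; s; t] ->
  x \notin [:: q; r; s; t; p] by move=> uD; split_uniq uD; by_conj.
have := cycle5_edge tf Ff C xu; rewrite (negbTE xC) /= => uC.
have C1 := cycle5_rot C; have C2 := cycle5_rot C1.
have C3 := cycle5_rot C2; have C4 := cycle5_rot C3.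
have xC1 := rot _ _ _ _ _ xC; have xC2 := rot _ _ _ _ _ xC1.
have xC3 := rot _ _ _ _ _ xC2; have xC4 := rot _ _ _ _ _ xC3.
move: uC xu; rewrite !inE => /or4P[/eqP->|/eqP->|/eqP->|/orP[]/eqP->].
- exact: center_nbr C xC.
- exact: center_nbr C1 xC1.
- exact: center_nbr C2 xC2.
- exact: center_nbr C3 xC3.
- exact: center_nbr C4 xC4.
Qed.

Lemma cover2_or_centered_cycle5 : (exists T : {set G}, #|T| <= 2 /\ covers T) \/
  exists a b c d e : G, centered_cycle5 a b c d e.
Proof.
have [|no5] := boolP [exists a : G, exists b : G, exists c : G, exists d : G,
    exists e : G, cycle5 a b c d e].
  move=> /existsP[a /existsP[b /existsP[c /existsP[d /existsP[e C]]]]].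
  by right; apply: cycle5_centered C.
left; apply: small_cover => // a b c d e; apply: contra no5 => C.
apply/existsP; exists a; apply/existsP; exists b; apply/existsP; exists c.
by apply/existsP; exists d; apply/existsP; exists e.
Qed.

End FiveCycle.

(** * Vertex covers and F-configurations *)

Lemma covers_three_edges (G : sgraph) (T : {set G}) (x1 y1 x2 y2 x3 y3 : G) :
    covers T -> uniq [:: x1; y1; x2; y2; x3; y3] ->
    x1 -- y1 -> x2 -- y2 -> x3 -- y3 ->
  2 < #|T|.
Proof.
move=> cT U e1 e2 e3; split_uniq U.
have pick x y : x -- y -> exists2 t, t \in T & t \in [:: x; y].
  by case/cT/orP=> h; [exists x | exists y]; rewrite ?inE ?eqxx ?orbT.
have [t1 T1 t1E] := pick _ _ e1; have [t2 T2 t2E] := pick _ _ e2.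
have [t3 T3 t3E] := pick _ _ e3.
have Ut : uniq [:: t1; t2; t3].
  move: t1E t2E t3E; rewrite !inE.
  by do 3 (case/orP=> /eqP->); by_conj.
rewrite -[3]/(size [:: t1; t2; t3]) -(card_uniqP Ut); apply/subset_leq_card.
by apply/subsetP=> z; rewrite !inE => /or3P[]/eqP->.
Qed.

(** If [xi] and [yj] coincided for different i and j, the edge from [xj] to [yj] would join two of
    the x's. *)
Lemma F_config_uniq (G : sgraph) (x1 x2 x3 y1 y2 y3 : G) :
  F_config x1 x2 x3 y1 y2 y3 -> uniq [:: x1; y1; x2; y2; x3; y3].
Proof.
case/and5P=> Ux Uy e1 e2 /and5P[e3 nx12 nx13 nx23 /and3P[ny12 ny13 ny23]].
have neq x y x' y' : x -- y -> x' -- y' -> ~~ x -- x' -> x != y' :> G.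
  move=> xy x'y'; apply: contraNneq => ->.
  by rewrite sedge_sym.
have N12 := neq _ _ _ _ e1 e2 nx12; have N13 := neq _ _ _ _ e1 e3 nx13.
have N23 := neq _ _ _ _ e2 e3 nx23.
have N21 : x2 != y1 by apply: neq e2 e1 _; rewrite sedge_sym.
have N31 : x3 != y1 by apply: neq e3 e1 _; rewrite sedge_sym.
have N32 : x3 != y2 by apply: neq e3 e2 _; rewrite sedge_sym.
have := sedge_neq e1; have := sedge_neq e2; have := sedge_neq e3 => *.
by split_uniq Ux; split_uniq Uy; by_conj.
Qed.

Lemma cover2_F_config_free (G : sgraph) (T : {set G}) :
  covers T -> #|T| <= 2 -> F_config_free G.
Proof.
move=> cT T2 x1 x2 x3 y1 y2 y3 F.
case/and5P: (F) => _ _ e1 e2 /and5P[e3 _ _ _ _].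
by have := covers_three_edges cT (F_config_uniq F) e1 e2 e3; rewrite ltnNge T2.
Qed.

(** * Bounds on chi and theta *)

Lemma chi_le (G : sgraph) (k : nat) (f : G -> 'I_k) :
  (forall x y, x -- y -> f x != f y) -> chi G <= k.
Proof.
move=> fP; rewrite /chi; case: ex_minnP => m _; apply.
apply/existsP; exists [ffun x => f x]; apply/forallP=> x; apply/forallP=> y.
by apply/implyP; rewrite !ffunE; apply: fP.
Qed.

Lemma chi_coloring (G : sgraph) :
  exists f : G -> 'I_(chi G), forall x y, x -- y -> f x != f y.
Proof.
have: colorable G (chi G) by rewrite /chi; case: ex_minnP.
case/existsP=> f /forallP fP; exists f => x y xy.
by move/forallP/(_ y)/implyP: (fP x); apply.
Qed.

Lemma chi_edge (G : sgraph) (x y : G) : x -- y -> 2 <= chi G.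
Proof.
move=> xy; have [f fP] := chi_coloring G.
move: (fP _ _ xy); rewrite -val_eqE ltnNge /=; apply: contraNN => le1.
have lt1 z : f z < 1 by exact: leq_trans (ltn_ord _) le1.
by move: (lt1 x) (lt1 y); do 2 (case: (nat_of_ord _) => //).
Qed.

Lemma chi_cycle5 (G : sgraph) (a b c d e : G) : cycle5 a b c d e -> 3 <= chi G.
Proof.
case/and5P=> ab bc cd de ea; have [f fP] := chi_coloring G.
move: (fP _ _ ab) (fP _ _ bc) (fP _ _ cd) (fP _ _ de) (fP _ _ ea).
rewrite ltnNge -!val_eqE /= => n1 n2 n3 n4 n5; apply/negP => le2.
have lt2 z : f z < 2 by exact: leq_trans (ltn_ord _) le2.
move: (lt2 a) (lt2 b) (lt2 c) (lt2 d) (lt2 e) n1 n2 n3 n4 n5.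
by do 5 (case: (nat_of_ord _) => [|[|?]] //).
Qed.

(** The complement of a cover is stable, hence a clique of [compl G], so a proper colouring of
    [compl G] is injective on it. *)
Lemma theta_cover (G : sgraph) (T : {set G}) :
  covers T -> #|G| <= #|T| + theta G.
Proof.
move=> cT; rewrite -(cardsC T) leq_add2l.
have [g gP] := chi_coloring (compl G).
rewrite -[theta G]card_ord -(card_in_imset (f := g : G -> _)) ?max_card //.
move=> x y; rewrite !inE => xT yT gxy; apply/eqP; apply: contraT => nxy.
suff: g x != g y by rewrite gxy eqxx.
apply: gP; rewrite /= /compl_rel nxy; apply/negP=> /cT.
by rewrite (negbTE xT) (negbTE yT).
Qed.

Section Induced.
Variables (G : sgraph) (S : {set G}).

Lemma induced_triangle_free : triangle_free G -> triangle_free (induced S).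
Proof. by move=> tf x y z; apply: tf. Qed.

Lemma induced_F_config_free : F_config_free G -> F_config_free (induced S).
Proof.
move=> Ff x1 x2 x3 y1 y2 y3 F.
by apply: (Ff (val x1) (val x2) (val x3) (val y1) (val y2) (val y3)).
Qed.
End Induced.

(** A non-isolated vertex off the cycle is adjacent to [a], hence not to [b] or [e]. On the cycle,
    the only pair avoiding [a], [c], [d] is [b], [e], which is a chord. *)
Lemma centered_cycle5_covers (G : sgraph) (a b c d e : G) :
    triangle_free G -> F_config_free G -> centered_cycle5 a b c d e ->
  covers [set a; c; d].
Proof.
move=> tf Ff [C cen].
have half x y : x -- y -> x \notin [:: a; b; c; d; e] -> y \in [set a; c; d].
  move=> xy xC; have xa := cen _ _ xC xy.
  have := cycle5_edge tf Ff C xy; rewrite (negbTE xC) /=.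
  case/and5P: C => ab _ _ _ ea.
  rewrite !inE => /or4P[/eqP->|/eqP yb|/eqP->|/orP[/eqP->|/eqP ye]];
    rewrite ?eqxx ?orbT //; subst.
  - by case: (tf _ _ _ xa ab xy).
  - by case: (tf _ _ _ xy ea xa).
move=> x y xy.
have [xC|xC] := boolP (x \in [:: a; b; c; d; e]);
  last by rewrite (half x y) ?orbT.
have [yC|yC] := boolP (y \in [:: a; b; c; d; e]); last first.
  by rewrite (half y x) // sedge_sym.
have C4 := cycle5_rot (cycle5_rot (cycle5_rot (cycle5_rot C))).
have := cycle5_chord tf C4.
move: xC yC xy; rewrite !inE.
by do 2 (case/or4P=> [/eqP->|/eqP->|/eqP->|/orP[]/eqP->]);
  rewrite ?eqxx ?orbT ?sedge_irrefl // sedge_sym => ->.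
Qed.

Lemma chi_theta_ge (G : sgraph) : triangle_free G -> F_config_free G ->
  #|G| <= chi G + theta G.
Proof.
move=> tf Ff.
have bound (T : {set G}) : covers T -> #|T| <= chi G -> #|G| <= chi G + theta G.
  by move=> /theta_cover le1 le2; apply: leq_trans le1 _; rewrite leq_add2r.
have [[T [T2 cT]]|[a [b [c [d [e C]]]]]] := cover2_or_centered_cycle5 tf Ff.
  have [/existsP[x /existsP[y xy]]|] :=
    boolP [exists x : G, exists y : G, x -- y].
    by apply: (bound T cT); apply: leq_trans T2 (chi_edge xy).
  rewrite negb_exists => /forallP nE.
  apply: (bound set0); rewrite ?cards0 // => x y xy.
  by move: (nE x); rewrite negb_exists => /forallP/(_ y); rewrite xy.
apply: bound (centered_cycle5_covers tf Ff C) _.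
case: C => C _; apply: leq_trans (chi_cycle5 C).
by rewrite -setUA cardsU1 cards2; case: (_ \notin _); case: (_ != _).
Qed.

(** * Consequences of 1-HNG and of omega = 2 *)

Lemma F_config_bipartition (G : sgraph) (x1 x2 x3 y1 y2 y3 u v : G) :
    F_config x1 x2 x3 y1 y2 y3 ->
    u \in [:: x1; y1; x2; y2; x3; y3] -> v \in [:: x1; y1; x2; y2; x3; y3] ->
  u -- v -> (u \in [:: x1; x2; x3]) != (v \in [:: x1; x2; x3]).
Proof.
case/and5P=> _ _ _ _ /and5P[_ nx12 nx13 nx23 /and3P[ny12 ny13 ny23]] us vs uv.
have stable3 (z1 z2 z3 : G) : ~~ z1 -- z2 -> ~~ z1 -- z3 -> ~~ z2 -- z3 ->
    u \in [:: z1; z2; z3] -> v \in [:: z1; z2; z3] -> ~~ u -- v.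
  move=> n12 n13 n23 ; rewrite !inE.
  by case/or3P=> /eqP-> /or3P[] /eqP->; rewrite ?sedge_irrefl // sedge_sym.
have inY (x : G) : x \in [:: x1; y1; x2; y2; x3; y3] ->
    x \notin [:: x1; x2; x3] -> x \in [:: y1; y2; y3].
  rewrite !inE => /or4P[/eqP->|/eqP->|/eqP->|/or3P[]/eqP->];
  by rewrite ?eqxx ?orbT.
have [uX|uX] := boolP (u \in [:: x1; x2; x3]);
  have [vX|vX] := boolP (v \in [:: x1; x2; x3]) => //.
  by have := stable3 _ _ _ nx12 nx13 nx23 uX vX; rewrite uv.
by have := stable3 _ _ _ ny12 ny13 ny23 (inY _ us uX) (inY _ vs vX); rewrite uv.
Qed.

(** The subgraph induced on an F-configuration is coloured by its two sides and covered by the three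
    matching edges as cliques, so chi + theta is at most 5, below its 6 vertices. *)
Lemma HNG1_F_config_free (G : sgraph) : HNG1 G -> F_config_free G.
Proof.
move=> hng x1 x2 x3 y1 y2 y3 F.
have U := F_config_uniq F.
case/and5P: (F) => _ _ e1 e2 /and5P[e3 _ _ _ _].
pose s := [:: x1; y1; x2; y2; x3; y3]; pose S := [set x in s].
have S6 : #|induced S| = 6.
  by rewrite card_sig cardsE /= (card_uniqP U).
have inS (x : induced S) : val x \in s by move: (valP x); rewrite inE.
have chi2 : chi (induced S) <= 2.
  pose f (x : G) : 'I_2 := inord (x \in [:: x1; x2; x3]).
  apply: (@chi_le _ _ (fun x : induced S => f (val x))) => x y xy.
  have := F_config_bipartition F (inS x) (inS y) xy.
  by rewrite -val_eqE /= !inordK; do ?case: (_ \in _).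
have theta3 : theta (induced S) <= 3.
  pose h (x : G) : 'I_3 :=
    if x \in [:: x1; y1] then inord 0 else
    if x \in [:: x2; y2] then inord 1 else inord 2.
  apply: (@chi_le (compl (induced S)) 3 (fun x => h (val x))) => x y.
  case/andP=> nxy nexy; have {}nxy : val x != val y by [].
  have {}nexy : ~~ val x -- val y by [].
  apply: contraNN nexy; move: (inS x) (inS y) nxy.
  move: (val x) (val y) => u v us vs nuv.
  have pair z t : z -- t -> u \in [:: z; t] -> v \in [:: z; t] -> u -- v.
    move=> zt; move: nuv; rewrite !inE => nuv /orP[]/eqP uE /orP[]/eqP vE;
    move: nuv; rewrite uE vE ?eqxx // => _; by rewrite sedge_sym.
  have third z : z \in s -> z \notin [:: x1; y1] -> z \notin [:: x2; y2] ->
      z \in [:: x3; y3].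
    rewrite -[s]/([:: x1; y1] ++ [:: x2; y2] ++ [:: x3; y3]) !mem_cat.
    by case/or3P=> // ->.
  rewrite /h -val_eqE; case: ifPn => u1; case: ifPn => v1;
    try (case: ifPn => u2); try (case: ifPn => v2);
    rewrite /= ?inordK // => _.
  - exact: pair e1 _ _.
  - exact: pair e2 _ _.
  - by apply: (pair _ _ e3); apply: third.
move: (hng S); rewrite S6 leqNgt; case/negP.
by apply: leq_ltn_trans (leq_add chi2 theta3) _.
Qed.

Lemma cliqueP (G : sgraph) (K : {set G}) :
  reflect {in K &, forall x y, x != y -> x -- y} (clique K).
Proof.
apply: (iffP forall_inP) => [H x y xK yK|H x xK].
  by move/forall_inP: (H x xK) => /(_ y yK)/implyP.
by apply/forall_inP=> y yK; apply/implyP; apply: H.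
Qed.

Lemma omega_eq2P (G : sgraph) (x y : G) : x -- y ->
  omega G = 2 <-> triangle_free G.
Proof.
move=> xy; split=> [om a b c ab bc ac|tf].
  have: #|[set a; b; c]| <= omega G.
    apply: (@leq_bigmax_cond _ _ (fun K : {set G} => #|K|)).
    apply/cliqueP=> u v; rewrite !inE -!orbA.
    by do 2 (case/or3P=> /eqP->); rewrite ?eqxx // sedge_sym.
  have := sedge_neq ab; have := sedge_neq bc; have := sedge_neq ac.
  rewrite om -setUA cardsU1 cards2 !inE negb_or => -> -> ->; by [].
apply/eqP; rewrite eqn_leq; apply/andP; split; last first.
  have <- : #|[set x; y]| = 2 by rewrite cards2 (sedge_neq xy).
  apply: (@leq_bigmax_cond _ _ (fun K : {set G} => #|K|)).
  apply/cliqueP=> u v; rewrite !inE.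
  by do 2 (case/orP=> /eqP->); rewrite ?eqxx // sedge_sym.
apply/bigmax_leqP=> K /cliqueP Kc; rewrite leqNgt; apply/negP => K3.
have [a [b [c [[aK bK cK] [nab nbc nca]]]]] := card_gt2P K3.
by apply: (tf a b c); apply: Kc; rewrite // eq_sym.
Qed.

(** * F-configurations and the graphs F_i *)

Lemma matching_card_le (G : sgraph) (M : {set {set G}}) :
  matching M -> 2 * #|M| <= #|G|.
Proof.
case/andP=> /subsetP Medge triv.
have -> : 2 * #|M| = #|cover M|.
  rewrite -(eqP triv) mulnC -sum_nat_const; apply: eq_bigr => e /Medge.
  by case/imsetP=> -[x y]; rewrite inE => xy ->; rewrite cards2 (sedge_neq xy).
exact: max_card.
Qed.

Lemma disjoint_set2 (T : finType) (x y z t : T) : uniq [:: x; y; z; t] ->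
  [disjoint [set x; y] & [set z; t]].
Proof.
move=> U; split_uniq U; apply/pred0P=> w /=; rewrite !inE.
by apply/negP=> /andP[/orP[]/eqP-> /orP[]/eqP E]; move: neq0 neq1 neq2 neq3;
  rewrite E eqxx.
Qed.

Lemma three_edges_matching (G : sgraph) (x1 y1 x2 y2 x3 y3 : G) :
    uniq [:: x1; y1; x2; y2; x3; y3] -> x1 -- y1 -> x2 -- y2 -> x3 -- y3 ->
  3 <= matching_number G.
Proof.
move=> U e1 e2 e3; split_uniq U.
have D12 : [disjoint [set x1; y1] & [set x2; y2]].
  by apply: disjoint_set2; by_conj.
have D13 : [disjoint [set x1; y1] & [set x3; y3]].
  by apply: disjoint_set2; by_conj.
have D23 : [disjoint [set x2; y2] & [set x3; y3]].
  by apply: disjoint_set2; by_conj.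
have neqD (x y : G) (B : {set G}) :
    [disjoint [set x; y] & B] -> [set x; y] != B.
  by apply: contraTneq => <-; rewrite -setI_eq0 setIid;
     apply/set0Pn; exists x; rewrite !inE eqxx.
pose M := [set [set x1; y1]; [set x2; y2]; [set x3; y3]].
have M3 : #|M| = 3.
  by rewrite /M -setUA cardsU1 cards2 !inE negb_or !neqD.
rewrite -M3; apply: (@leq_bigmax_cond _ _ (fun M : {set {set G}} => #|M|)).
apply/andP; split.
  apply/subsetP=> A; rewrite !inE -orbA => AM; apply/imsetP.
  case/or3P: AM => /eqP->;
    [exists (x1, y1) | exists (x2, y2) | exists (x3, y3)];
    by rewrite ?inE.
apply/trivIsetP=> A B; rewrite !inE -!orbA.
by case/or3P=> /eqP-> /or3P[]/eqP->; rewrite ?eqxx // disjoint_sym.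
Qed.

Lemma F_config_is_F (G : sgraph) (x1 x2 x3 y1 y2 y3 : G) :
  F_config x1 x2 x3 y1 y2 y3 ->
  is_F (induced [set x in [:: x1; y1; x2; y2; x3; y3]]).
Proof.
move=> F; have U := F_config_uniq F.
case/and5P: (F) => _ _ e1 e2 /and5P[e3 _ _ _ _].
set s := [:: _; _; _; _; _; _]; set S := [set x in s].
have S6 : #|induced S| = 6 by rewrite card_sig cardsE /= (card_uniqP U).
have inS (x : induced S) : val x \in s by move: (valP x); rewrite inE.
split=> //.
  exists [set x | val x \in [:: x1; x2; x3]] => x y xy.
  rewrite [x \in _]in_set [y \in _]in_set.
  exact: F_config_bipartition F (inS x) (inS y) xy.
apply/eqP; rewrite eqn_leq; apply/andP; split.
  apply/bigmax_leqP=> M /matching_card_le.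
  by rewrite S6 -[6]/(2 * 3) leq_pmul2l.
have ex (z : G) : z \in s -> exists u : induced S, val u = z.
  by move=> zs; have zS : z \in S; [rewrite inE | exists (Sub z zS)].
have [|u1 U1] := ex x1; first by rewrite !inE eqxx ?orbT.
have [|u2 U2] := ex x2; first by rewrite !inE eqxx ?orbT.
have [|u3 U3] := ex x3; first by rewrite !inE eqxx ?orbT.
have [|v1 V1] := ex y1; first by rewrite !inE eqxx ?orbT.
have [|v2 V2] := ex y2; first by rewrite !inE eqxx ?orbT.
have [|v3 V3] := ex y3; first by rewrite !inE eqxx ?orbT.
apply: (@three_edges_matching _ u1 v1 u2 v2 u3 v3).
- by rewrite -(map_inj_uniq val_inj) /= -/(uniq s) U1 U2 U3 V1 V2 V3.
- by rewrite /= /induced_rel U1 V1.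
- by rewrite /= /induced_rel U2 V2.
- by rewrite /= /induced_rel U3 V3.
Qed.

(** Three matching edges, each oriented from [A] to its complement, form an F-configuration because
    both sides of the bipartition are stable. *)
Lemma is_F_config (H : sgraph) : is_F H ->
  exists x1 x2 x3 y1 y2 y3 : H, F_config x1 x2 x3 y1 y2 y3.
Proof.
case=> _ [A bip] nu3.
have [M Mm M3] : exists2 M : {set {set H}}, matching M & #|M| = 3.
  (* The empty matching makes the maximum range over a nonempty family, so that it is attained. *)
  have m0 : matching (set0 : {set {set H}}).
    by rewrite /matching sub0set /trivIset /cover !big_set0 cards0.
  have [|M Mm ME] := @eq_bigmax_cond _ (@matching H) (fun M => #|M|).
    by apply/card_gt0P; exists set0.
  by exists M; rewrite // -ME.
have M_gt2 : 2 < #|M| by rewrite M3.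
have [a [b [c [[aM bM cM] [nab nbc nca]]]]] := card_gt2P M_gt2.
case/andP: Mm => /subsetP Me /trivIsetP triv.
have orient e : e \in M ->
    exists x y : H, [/\ e = [set x; y], x -- y, x \in A & y \notin A].
  move=> /Me/imsetP[[x y]]; rewrite inE /= => xy ->.
  have [xA|xA] := boolP (x \in A).
    by exists x, y; split=> //; have := bip _ _ xy; rewrite xA; case: (y \in A).
  exists y, x; split=> //; first exact: setUC.
    by rewrite sedge_sym.
  by have := bip _ _ xy; rewrite (negbTE xA); case: (y \in A).
have D12 := triv _ _ aM bM nab; have D23 := triv _ _ bM cM nbc.
have D31 := triv _ _ cM aM nca.
have [x1 [y1 [E1 xy1 x1A y1A]]] := orient _ aM.
have [x2 [y2 [E2 xy2 x2A y2A]]] := orient _ bM.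
have [x3 [y3 [E3 xy3 x3A y3A]]] := orient _ cM.
have neq (u v : H) (B C : {set H}) :
    [disjoint B & C] -> u \in B -> v \in C -> u != v.
  move=> D uB vC; apply: contraTneq vC => <-.
  by rewrite (disjointFr D uB).
have nA u v : (u \in A) = (v \in A) -> ~~ u -- v.
  by move=> E; apply/negP => /bip; rewrite E eqxx.
have T1 : x1 != x2 by apply: neq D12 _ _; rewrite ?E1 ?E2 !inE eqxx ?orbT.
have T2 : x2 != x3 by apply: neq D23 _ _; rewrite ?E2 ?E3 !inE eqxx ?orbT.
have T3 : x3 != x1 by apply: neq D31 _ _; rewrite ?E3 ?E1 !inE eqxx ?orbT.
have W1 : y1 != y2 by apply: neq D12 _ _; rewrite ?E1 ?E2 !inE eqxx ?orbT.
have W2 : y2 != y3 by apply: neq D23 _ _; rewrite ?E2 ?E3 !inE eqxx ?orbT.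
have W3 : y3 != y1 by apply: neq D31 _ _; rewrite ?E3 ?E1 !inE eqxx ?orbT.
exists x1, x2, x3, y1, y2, y3.
rewrite /F_config !nA ?(negbTE y1A, negbTE y2A, negbTE y3A, x1A, x2A, x3A) //.
by by_conj.
Qed.

(** Replaces the quantification over all graphs isomorphic to some F_i by configurations of vertices
    of [G]. *)
Lemma K3_F_freeP (G : sgraph) :
  K3_F_free G <-> triangle_free G /\ F_config_free G.
Proof.
split=> [[K3f Ff]|[tf Ff]]; split.
- move=> x y z xy yz xz; apply: K3f.
  exists (fun i : 'I_3 => nth x [:: x; y; z] i).
  have U : uniq [:: x; y; z].
    have := sedge_neq xy; have := sedge_neq yz; have := sedge_neq xz => *.
    by by_conj.
  have inj : injective (fun i : 'I_3 => nth x [:: x; y; z] i).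
    by move=> i j /eqP; rewrite nth_uniq // => /eqP/val_inj.
  split=> // i j; rewrite [RHS]/(i != j).
  have [->|] := eqVneq i j; first by rewrite sedge_irrefl.
  case: i j => [[|[|[|//]]] ?] [[|[|[|//]]] ?] //= _; by rewrite sedge_sym.
- move=> x1 x2 x3 y1 y2 y3 F; apply: (Ff _ (F_config_is_F F)).
  by exists val; split=> //; apply: val_inj.
- case=> f [inj fE].
  pose o (k : nat) : complete 3 := (inord k : 'I_3).
  apply: (tf (f (o 0)) (f (o 1)) (f (o 2))); rewrite fE /= /complete_rel;
    by rewrite -val_eqE /= !inordK.
move=> H /is_F_config[x1 [x2 [x3 [y1 [y2 [y3 F]]]]]] [f [inj fE]].
apply: (Ff (f x1) (f x2) (f x3) (f y1) (f y2) (f y3)).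
move: F; rewrite /F_config !fE.
by rewrite -![[:: f _; _; _]]/(map f [:: _; _; _]) !(map_inj_uniq inj).
Qed.

(** * Subgraphs of K_{2,n-2} and of double stars are K_3- and F_i-free *)

Lemma K3_F_free_cover2 (G : sgraph) (T : {set G}) :
  triangle_free G -> covers T -> #|T| <= 2 -> K3_F_free G.
Proof.
move=> tf cT T2; apply/K3_F_freeP; split=> //.
exact: cover2_F_config_free T2.
Qed.

(** Containing no induced F_i need not pass to non-induced subgraphs, but triangle-freeness and a
    cover of size at most 2 do, the cover by preimage under the injection. *)
Lemma subgraph_cover2 (G K : sgraph) (T : {set K}) :
  triangle_free K -> covers T -> #|T| <= 2 -> is_subgraph G K -> K3_F_free G.
Proof.
move=> tf cT T2 [f [inj hom]].
apply: (@K3_F_free_cover2 G (f @^-1: T)).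
- by move=> x y z /hom xy /hom yz /hom; apply: tf xy yz.
- by move=> x y /hom/cT; rewrite !inE.
apply: leq_trans T2; rewrite -(card_imset _ inj); apply: subset_leq_card.
by apply/subsetP=> _ /imsetP[x xT ->]; move: xT; rewrite inE.
Qed.

Lemma subgraph_complete_bipartite2 (G : sgraph) (l : nat) :
  is_subgraph G (complete_bipartite 2 l) -> K3_F_free G.
Proof.
pose T : {set complete_bipartite 2 l} := [set inl ord0; inl ord_max].
apply: (@subgraph_cover2 _ _ T).
- by case=> i [] j [] k.
- by case=> [[[|[|//]] ?]|?] [[[|[|//]] ?]|?] //= _; rewrite !inE.
- by rewrite cards2.
Qed.

Lemma subgraph_double_star (G : sgraph) (a b : nat) :
  is_subgraph G (double_star a b) -> K3_F_free G.
Proof.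
pose T : {set double_star a b} := [set inl None; inr None].
apply: (@subgraph_cover2 _ _ T).
- by case=> [[?|]|[?|]] [[?|]|[?|]] [[?|]|[?|]].
- by case=> [[?|]|[?|]] [[?|]|[?|]] //= _; rewrite !inE.
- by rewrite cards2.
Qed.

Ltac simp_neq :=
  repeat match goal with
  | H : is_true (?x != ?y) |- context [?x == ?y] => rewrite (negbTE H)
  | H : is_true (?x != ?y) |- context [?y == ?x] =>
      rewrite [y == x]eq_sym [x == y](negbTE H)
  end.

(** * Symmetries of F-configurations *)

Section Permute.
Variables (G : sgraph) (x1 x2 x3 y1 y2 y3 : G).
Hypothesis F : F_config x1 x2 x3 y1 y2 y3.

Ltac permute := let Ux := fresh in let Uy := fresh in
  case/and5P: F => Ux Uy ? ? /and5P[? ? ? ? /and3P[? ? ?]];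
  split_uniq Ux; split_uniq Uy; by_conj.

Lemma F_config_swap : F_config y1 y2 y3 x1 x2 x3. Proof. permute. Qed.
Lemma F_config_perm12 : F_config x2 x1 x3 y2 y1 y3. Proof. permute. Qed.
Lemma F_config_perm23 : F_config x1 x3 x2 y1 y3 y2. Proof. permute. Qed.
End Permute.

(** * Members of D_3 are K_3- and F_i-free; [a], [c], [d] stand for c_1, c_3, c_4 *)

Section ThreeCover.
Variables (G : sgraph) (a c d : G).
Hypotheses (cov : covers [set a; c; d]) (cd : c -- d).
Hypotheses (nac : ~~ a -- c) (nad : ~~ a -- d).
Hypothesis c_nbr : forall z, z -- c -> z != d -> z -- a.
Hypothesis d_nbr : forall z, z -- d -> z != c -> z -- a.
Hypothesis cd_nbr : forall z, z -- c -> ~~ z -- d.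

(** A triangle has two vertices in the cover. The only edge inside the cover is [cd], and [c], [d]
    have no common neighbour. *)
Lemma cover3_triangle_free : triangle_free G.
Proof.
have inT x y z : x \in [set a; c; d] -> y \in [set a; c; d] ->
    x -- y -> z -- x -> z -- y -> False.
  rewrite !inE -!orbA => xT yT xy zx zy; apply/negP: xy.
  move: xT yT zx zy; case/or3P=> /eqP-> /or3P[]/eqP-> zx zy;
    rewrite ?sedge_irrefl // 1?sedge_sym //.
  - by move: (cd_nbr zx); rewrite zy.
  - by move: (cd_nbr zy); rewrite zx.
move=> x y z xy yz xz.
have yx : y -- x by rewrite sedge_sym.
have zx : z -- x by rewrite sedge_sym.
have zy : z -- y by rewrite sedge_sym.
have [xT|xT] := boolP (x \in [set a; c; d]).
  case/orP: (cov yz) => [yT|zT]; first exact: inT xT yT xy zx zy.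
  exact: inT xT zT xz yx yz.
have yT : y \in [set a; c; d] by move: (cov xy); rewrite (negbTE xT).
have zT : z \in [set a; c; d] by move: (cov xz); rewrite (negbTE xT).
exact: inT yT zT yz xy xz.
Qed.

(** As [c] and [d] are adjacent, they lie on opposite sides, and so do their partners. Both partners
    are adjacent to [a], but one of them is on the side of [a]. *)
Let aligned (x1 x2 x3 y1 y2 y3 : G) : F_config x1 x2 x3 y1 y2 y3 ->
  c \in [:: x1; y1] -> d \in [:: x2; y2] -> a \in [:: x3; y3] -> False.
Proof.
have half z1 z2 z3 t1 t2 t3 : F_config z1 z2 z3 t1 t2 t3 ->
    c = z1 -> d \in [:: z2; t2] -> a \in [:: z3; t3] -> False.
  move=> F cE; have U := F_config_uniq F.
  case/and5P: F => _ _ e1 e2 /and5P[e3 n12 n13 n23 /and3P[m12 m13 m23]].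
  rewrite !inE => /orP[]/eqP dE; first by move: n12; rewrite -cE -dE cd.
  have t1a : t1 -- a.
    by apply: c_nbr; [rewrite cE sedge_sym | rewrite dE; split_uniq U; by_conj].
  have z2a : z2 -- a.
    by apply: d_nbr; [rewrite dE | rewrite cE; split_uniq U; by_conj].
  by case/orP=> /eqP aE; [move: n23 z2a | move: m13 t1a];
    rewrite -aE => /negbTE->.
move=> F; rewrite in_cons mem_seq1 => /orP[]/eqP cE dE aE.
  exact: half F cE dE aE.
have F' := F_config_swap F.
have sw (u v w : G) : u \in [:: v; w] -> u \in [:: w; v].
  by rewrite !inE orbC.
exact: half F' cE (sw _ _ _ dE) (sw _ _ _ aE).
Qed.

(* Each of a, c, d lies on its own edge of the matching; then c, d, their
   partners and a form a 5-cycle, which is not bipartite. *)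
Lemma cover3_F_config_free : F_config_free G.
Proof.
move=> x1 x2 x3 y1 y2 y3 F; have U := F_config_uniq F.
have F12 := F_config_perm12 F; have F23 := F_config_perm23 F.
have F12_23 := F_config_perm23 F12; have F23_12 := F_config_perm12 F23.
have F13 := F_config_perm12 F12_23.
case/and5P: (F) => _ _ e1 e2 /and5P[e3 _ _ _ _].
have pick x y : x -- y ->
    [\/ a \in [:: x; y], c \in [:: x; y] | d \in [:: x; y]].
  move/cov; rewrite !inE -!orbA => H.
  have {H} : [|| (x == a) || (y == a), (x == c) || (y == c)
               | (x == d) || (y == d)].
    by move: H; do 6!case: (_ == _).
  by rewrite ![x == _]eq_sym ![y == _]eq_sym => /or3P.
have neq z : z \in [:: x1; y1] -> z \in [:: x2; y2] -> False.
  by split_uniq U; rewrite !inE => /orP[]/eqP-> /orP[]; simp_neq.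
have neq' z : z \in [:: x1; y1] -> z \in [:: x3; y3] -> False.
  by split_uniq U; rewrite !inE => /orP[]/eqP-> /orP[]; simp_neq.
have neq'' z : z \in [:: x2; y2] -> z \in [:: x3; y3] -> False.
  by split_uniq U; rewrite !inE => /orP[]/eqP-> /orP[]; simp_neq.
by case: (pick _ _ e1) => h1; case: (pick _ _ e2) => h2;
  case: (pick _ _ e3) => h3;
  first [exact: neq h1 h2 | exact: neq' h1 h3 | exact: neq'' h2 h3
       | exact: aligned F _ _ _ | exact: aligned F12 _ _ _
       | exact: aligned F23 _ _ _ | exact: aligned F12_23 _ _ _
       | exact: aligned F23_12 _ _ _ | exact: aligned F13 _ _ _].
Qed.
End ThreeCover.

Lemma in_D3_config_free (G : sgraph) : in_D3 G ->
  triangle_free G /\ F_config_free G.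
Proof.
case=> c1 [c2 [c3 [c4 [c5 [/= U adj _ nb]]]]]; split_uniq U.
have inC k : k \in [:: c1; c2; c3; c4; c5] -> k \in [set c1; c2; c3; c4; c5].
  by rewrite !inE -!orbA.
have [e12 e23 e34 e45 e15] :
    [/\ c1 -- c2, c2 -- c3, c3 -- c4, c4 -- c5 & c1 -- c5].
  by split; rewrite adj ?inC ?inE ?eqxx ?orbT.
have [n13 n14 n24 n25 n35] :
    [/\ ~~ c1 -- c3, ~~ c1 -- c4, ~~ c2 -- c4, ~~ c2 -- c5 & ~~ c3 -- c5].
  by split; rewrite adj ?inC ?inE ?eqxx ?orbT // !xpair_eqE; simp_neq;
    rewrite ?andbF.
(* What the three admissible neighbourhoods have in common: they contain [c1], lie in the cover
   [c1], [c3], [c4], and miss [c3] or [c4]. *)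
have out z t : z \notin [:: c1; c2; c3; c4; c5] -> z -- t ->
    [/\ z -- c1, t \in [set c1; c3; c4] & ~~ (z -- c3 && z -- c4)].
  move=> zC; have zC' : z \in ~: [set c1; c2; c3; c4; c5].
    by move: zC; rewrite !inE -!orbA.
  have memN (A : {set G}) : neighborhood z = A -> forall y, z -- y = (y \in A).
    by move=> <- y; rewrite inE.
  have nbz := nb z zC'.
  have [] : [\/ neighborhood z = [set c1], neighborhood z = [set c1; c3] |
      neighborhood z = [set c1; c4]].
    move: nbz; rewrite in_cons in_cons mem_seq1.
    by case/or3P=> /eqP; [apply: Or31 | apply: Or32 | apply: Or33].
  - by move/memN=> E; rewrite !E !inE eqxx => ->; split=> //; simp_neq.
  - move/memN=> E; rewrite !E !inE eqxx => ->; split=> //.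
    by simp_neq; rewrite andbF.
  - by move/memN=> E; rewrite !E !inE eqxx => /orP[]->; rewrite ?orbT;
      split=> //; simp_neq.
have case5 (P : G -> Prop) : P c1 -> P c2 -> P c3 -> P c4 -> P c5 ->
    (forall z, z \notin [:: c1; c2; c3; c4; c5] -> P z) -> forall z, P z.
  move=> P1 P2 P3 P4 P5 PN z.
  have [|/PN//] := boolP (z \in [:: c1; c2; c3; c4; c5]).
  by rewrite !inE => /or4P[/eqP->|/eqP->|/eqP->|/orP[]/eqP->].
have cov : covers [set c1; c3; c4].
  move=> x y; elim/case5: x => [|||||z zC /(out _ _ zC)[_ -> _]];
    [ | | | | |by rewrite orbT]; rewrite !inE ?eqxx ?orbT //.
  - elim/case5: y => [|||||z zC];
      rewrite ?eqxx ?orbT ?sedge_irrefl ?(negbTE n25) //.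
    by rewrite sedge_sym => /(out _ _ zC)[_]; rewrite !inE; simp_neq.
  - elim/case5: y => [|||||z zC]; rewrite ?eqxx ?orbT ?sedge_irrefl //.
      by rewrite sedge_sym (negbTE n25).
    by rewrite sedge_sym => /(out _ _ zC)[_]; rewrite !inE; simp_neq.
have n53 : ~~ c5 -- c3 by rewrite sedge_sym.
have e21 : c2 -- c1 by rewrite sedge_sym.
have e51 : c5 -- c1 by rewrite sedge_sym.
have c3n z : z -- c3 -> z != c4 -> z -- c1.
  elim/case5: z => [|||||z zC /(out _ _ zC)[->//]];
  by rewrite ?sedge_irrefl ?eqxx ?(negbTE n13) ?(negbTE n53).
have c4n z : z -- c4 -> z != c3 -> z -- c1.
  elim/case5: z => [|||||z zC /(out _ _ zC)[->//]];
  by rewrite ?sedge_irrefl ?eqxx ?(negbTE n14) ?(negbTE n24).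
have c34n z : z -- c3 -> ~~ z -- c4.
  elim/case5: z => [|||||z zC zc3]; rewrite ?n14 ?n24 ?sedge_irrefl //.
    by rewrite (negbTE n53).
  by have [_ _] := out _ _ zC zc3; rewrite zc3.
split; first exact: cover3_triangle_free cov n13 n14 c34n.
exact: cover3_F_config_free cov e34 c3n c4n.
Qed.

(** Every vertex of a triangle or of an F-configuration has a neighbour, hence lies in [S]. *)
Lemma in_D3_plus_isolated_K3_F_free (G : sgraph) :
  in_D3_plus_isolated G -> K3_F_free G.
Proof.
case=> S [/in_D3_config_free[tf Ff] iso].
have inS x y : x -- y -> x \in S.
  by move=> xy; apply: contraT => /iso/setP/(_ y); rewrite !inE xy.
apply/K3_F_freeP; split=> [x y z xy yz xz|x1 x2 x3 y1 y2 y3 F].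
  have zx : z -- x by rewrite sedge_sym.
  by apply: (tf (Sub x (inS _ _ xy)) (Sub y (inS _ _ yz)) (Sub z (inS _ _ zx))).
case/and5P: (F) => _ _ e1 e2 /and5P[e3 _ _ _ _].
have [f1 f2 f3] : [/\ y1 -- x1, y2 -- x2 & y3 -- x3].
  by rewrite ![y1 -- _]sedge_sym ![y2 -- _]sedge_sym ![y3 -- _]sedge_sym.
by apply: (Ff (Sub x1 (inS _ _ e1)) (Sub x2 (inS _ _ e2)) (Sub x3 (inS _ _ e3))
           (Sub y1 (inS _ _ f1)) (Sub y2 (inS _ _ f2)) (Sub y3 (inS _ _ f3))).
Qed.

(** * Embedding a graph with a small cover into K_{2,n-2} or a double star *)

(** The map is the position in an enumeration of [A]. The [option] makes [g] total even when ['I_k]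
    is empty. *)
Lemma enum_option_inj (T : finType) (A : {set T}) (k : nat) : #|A| <= k ->
  exists g : T -> option 'I_k, {in A, forall x, g x} /\ {in A &, injective g}.
Proof.
move=> Ak; exists (fun x => insub (index x (enum A))); split=> [x xA|x y xA yA].
  by rewrite insubT // (leq_trans _ Ak) // cardE index_mem mem_enum.
have lt z : z \in A -> index z (enum A) < k.
  by move=> zA; rewrite (leq_trans _ Ak) // cardE index_mem mem_enum.
rewrite !insubT ?lt // => ? ?; case=> E.
by apply: (index_inj x (s := enum A)); rewrite ?mem_enum.
Qed.

(** A superset of a cover is a cover, so a smaller one can be padded to two distinct vertices. *)
Lemma covers_pair (G : sgraph) (T : {set G}) :
    1 < #|G| -> covers T -> #|T| <= 2 ->
  exists a b : G, a != b /\ covers [set a; b].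
Proof.
move=> G2 cT T2.
have mono (T' : {set G}) : T \subset T' -> covers T'.
  by move=> /subsetP TT' x y /cT/orP[/TT'->|/TT'->]; rewrite ?orbT.
have [a [b [_ _ nab]]] := card_gt1P G2.
have [/cards2P[x [y [nxy E]]]|T_n2] := boolP (#|T| == 2).
  by exists x, y; rewrite -E.
have [/cards1P[x E]|T_n1] := boolP (#|T| == 1).
  exists x, (if x == a then b else a); split.
    by case: (eqVneq x a) => [->|].
  by apply: mono; rewrite E; apply/subsetP=> z; rewrite !inE => ->.
exists a, b; split=> //; apply: mono.
have -> : T = set0.
  apply/eqP; rewrite -cards_eq0; move: T2 T_n2 T_n1.
  by case: #|T| => [|[|[|]]].
exact: sub0set.
Qed.

(** Let [a], [b] cover all edges. If they are not adjacent, they form the side of size 2 of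
    K_{2,n-2}. If they are, they become the centres of a double star, since no third vertex is
    adjacent to both. *)
Lemma cover2_subgraph (n : nat) (G : sgraph) (T : {set G}) : #|G| = n ->
    triangle_free G -> covers T -> #|T| <= 2 ->
  is_subgraph G (complete_bipartite 2 (n - 2)) \/
  exists m : nat, 0 < m < n /\ is_subgraph G (double_star m (n - m)).
Proof.
move=> hn tf cT T2; have [n_le1|n_gt1] := leqP n 1.
  have eqG (x y : G) : x = y.
    have: #|G| <= 1 by rewrite hn.
    by move/fintype_le1P=> H; apply: H.
  left; exists (fun=> inl ord0); split=> [x y _|x y]; first exact: eqG.
  by rewrite (eqG y x) sedge_irrefl.
rewrite -hn in n_gt1; have [a [b [nab cov]]] := covers_pair n_gt1 cT T2.
have [ab|neab] := boolP (a -- b); last first.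
  left; have restC : #|~: [set a; b]| <= n - 2.
    by rewrite cardsCs setCK cards2 nab hn.
  have [g [gS gI]] := enum_option_inj restC.
  (* The last default is never reached: [g] has a value at every vertex other than [a] and [b]. *)
  pose f x : complete_bipartite 2 (n - 2) :=
    if x == a then inl ord0 else if x == b then inl ord_max
    else if g x is Some i then inr i else inl ord0.
  have gSome x : x != a -> x != b -> exists i, g x = Some i.
    move=> xa xb; have : x \in ~: [set a; b] by rewrite !inE negb_or xa.
    by move/gS; case: (g x) => // i _; exists i.
  have fa : f a = inl ord0 by rewrite /f eqxx.
  have fb : f b = inl ord_max by rewrite /f eq_sym (negbTE nab) eqxx.
  have fo x : x != a -> x != b -> exists2 i, g x = Some i & f x = inr i.
    move=> xa xb; have [i gi] := gSome x xa xb; exists i => //.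
    by rewrite /f (negbTE xa) (negbTE xb) gi.
  have half x y : x -- y -> x \in [set a; b] -> f x -- f y.
    have neba : ~~ b -- a by rewrite sedge_sym.
    move=> xy; rewrite !inE => xT.
    have ya : y != a.
      apply: contraTneq xy => ->.
      by case/orP: xT => /eqP->; rewrite ?sedge_irrefl.
    have yb : y != b.
      apply: contraTneq xy => ->.
      by case/orP: xT => /eqP->; rewrite ?sedge_irrefl.
    have [i _ ->] := fo _ ya yb.
    by case/orP: xT => /eqP->; rewrite ?fa ?fb.
  exists f; split=> [x y|x y xy].
    case: (eqVneq x a) => [->|xa]; case: (eqVneq y a) => [->|ya] //.
    - case: (eqVneq y b) => [->|yb]; rewrite fa ?fb //.
      by have [i _ ->] := fo _ ya yb.
    - case: (eqVneq x b) => [->|xb]; rewrite fa ?fb //.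
      by have [i _ ->] := fo _ xa xb.
    case: (eqVneq x b) => [->|xb]; case: (eqVneq y b) => [->|yb] //.
    - by have [i _ ->] := fo _ ya yb; rewrite fb.
    - by have [i _ ->] := fo _ xa xb; rewrite fb.
    have [i gx ->] := fo _ xa xb; have [j gy ->] := fo _ ya yb; case=> ij.
    by apply: gI; rewrite ?inE ?negb_or ?xa ?ya // gx gy ij.
  case/orP: (cov _ _ xy); first exact: half.
  by rewrite sedge_sym; apply: half; rewrite sedge_sym.
(* [B] holds the pendant vertices of [b]; all others, including those adjacent to neither centre,
   are hung on [a]. *)
right; pose B := [set x | (b -- x) && (x != a)].
pose A := ~: B :\: [set a; b].
have aB : a \notin B by rewrite inE eqxx andbF.
have bB : b \notin B by rewrite inE sedge_irrefl.
have AB : #|A| + #|B| = n - 2.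
  have : #|[set a; b] :|: B| = 2 + #|B|.
    rewrite cardsU cards2 nab (_ : _ :&: B = set0) ?cards0 ?subn0 //.
    apply/setP=> x; rewrite in_setI in_set2 in_set0; apply/negP=> /andP[].
    by case/orP=> /eqP->; [rewrite (negbTE aB) | rewrite (negbTE bB)].
  have -> : A = ~: ([set a; b] :|: B) by rewrite /A setCU setDE setIC.
  move=> E; rewrite -hn -(cardsC ([set a; b] :|: B)) E.
  by rewrite addnC -addnA addKn addnC.
(* The degree of the centre [a] in the double star: its pendant vertices [A] and the other
   centre. *)
exists #|A|.+1.
have nE : n = #|A| + (#|B| + 2) by rewrite addnA AB subnK // -hn.
have BE : (n - #|A|.+1).-1 = #|B|.
  by rewrite -subnS nE -[#|A|.+2]addn2 subnDl addnK.
split; first by rewrite nE addnA addn2 !ltnS leq_addr.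
have [g [gS gI]] := enum_option_inj (leqnn #|A|).
have [h [hS hI]] := enum_option_inj (eq_leq (esym BE)).
pose f x : double_star #|A|.+1 (n - #|A|.+1) :=
  if x == a then inl None else if x == b then inr None
  else if x \in B then inr (h x) else inl (g x).
have fa : f a = inl None by rewrite /f eqxx.
have fb : f b = inr None by rewrite /f eq_sym (negbTE nab) eqxx.
have fB x : x \in B -> exists2 i, h x = Some i & f x = inr (Some i).
  move=> xB; have := hS _ xB; case E: (h x) => [i|] // _; exists i => //.
  rewrite /f xB E; case: eqP xB => [->|_ xB]; first by rewrite (negbTE aB).
  by case: eqP xB => // ->; rewrite (negbTE bB).
have fA x : x \in A -> exists2 i, g x = Some i & f x = inl (Some i).
  move=> xA; have := gS _ xA; case E: (g x) => [i|] // _; exists i => //.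
  move: xA; rewrite in_setD in_set2 in_setC negb_or => /andP[/andP[xa xb] xB].
  by rewrite /f (negbTE xa) (negbTE xb) (negbTE xB) E.
have cases x : [\/ x = a, x = b, x \in A | x \in B].
  have [->|xa] := eqVneq x a; first exact: Or41.
  have [->|xb] := eqVneq x b; first exact: Or42.
  have [xB|xB] := boolP (x \in B); first exact: Or44.
  by apply: Or43; rewrite in_setD in_setC xB !inE negb_or xa xb.
exists f; split=> [x y|].
  case: (cases x) => [->|->|/[dup] xA /fA[i gx ->]|/[dup] xB /fB[i hx ->]];
  case: (cases y) => [->|->|/[dup] yA /fA[j gy ->]|/[dup] yB /fB[j hy ->]];
  rewrite ?fa ?fb //; case=> ij; [apply: gI | apply: hI] => //.
    by rewrite gx gy ij.
  by rewrite hx hy ij.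
have half x y : x -- y -> x \in [set a; b] -> f x -- f y.
  move=> xy; rewrite !inE => /orP[]/eqP xE; subst x; rewrite ?fa ?fb.
    case: (cases y) xy => [->|->|/fA[j _ ->]|yB ay] //;
      rewrite ?sedge_irrefl ?fb //.
    by move: yB; rewrite inE => /andP[by_ _]; case: (tf _ _ _ ab by_ ay).
  case: (cases y) xy => [->|->|yA by_|/fB[j _ ->]] //;
    rewrite ?sedge_irrefl ?fa //.
  move: yA; rewrite !inE negb_or by_ /= => /andP[/andP[ya _]]; by rewrite ya.
move=> x y xy; case/orP: (cov _ _ xy); first exact: half.
by rewrite sedge_sym; apply: half; rewrite sedge_sym.
Qed.

(** * A centred 5-cycle puts the graph in D_3 up to isolated vertices *)

(** A vertex off the cycle is adjacent to [a], hence not to [b] or [e], and not to both of the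
    adjacent vertices [c], [d]. This leaves the three neighbourhoods of D_3. *)
Lemma centered_cycle5_in_D3 (G : sgraph) (a b c d e : G) :
    triangle_free G -> F_config_free G -> centered_cycle5 a b c d e ->
    (forall x : G, exists y, x -- y) ->
  in_D3 G.
Proof.
move=> tf Ff [C cen] noniso; exists a, b, c, d, e => /=.
have U := cycle5_uniq tf C.
have chord := cycle5_chord tf.
have C1 := cycle5_rot C; have C2 := cycle5_rot C1.
have C3 := cycle5_rot C2; have C4 := cycle5_rot C3.
move: (chord _ _ _ _ _ C) (chord _ _ _ _ _ C1) (chord _ _ _ _ _ C2).
move: (chord _ _ _ _ _ C3) (chord _ _ _ _ _ C4) => nda neb nac nbd nce.
case/and5P: (C) => ab bc cd de ea.
have inC x : (x \in [set a; b; c; d; e]) = (x \in [:: a; b; c; d; e]).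
  by rewrite !inE -!orbA.
split=> //.
- move=> x y; rewrite !inC; move: (U) => U'; split_uniq U'.
  rewrite [x \in _]inE [y \in _]inE !in_cons !in_nil !orbF.
  case/or4P=> [/eqP->|/eqP->|/eqP->|/orP[]/eqP->];
  case/or4P=> [/eqP->|/eqP->|/eqP->|/orP[]/eqP->];
  rewrite ?inE !xpair_eqE ?eqxx; simp_neq;
  rewrite ?andbF ?orbF ?orbT ?sedge_irrefl //;
  by [apply/negbTE | rewrite sedge_sym | rewrite sedge_sym; apply/negbTE].
- apply/forall_inP=> x; rewrite in_setC inC => xC.
  apply/forall_inP=> y; rewrite in_setC inC => yC; apply/negP.
  by move=> /(cycle5_edge tf Ff C); rewrite (negbTE xC) (negbTE yC).
move=> v; rewrite in_setC inC => vC.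
have [u vu] := noniso v; have va := cen _ _ vC vu.
have nvb : ~~ v -- b by apply: triangle_freeN va ab.
have nve : ~~ v -- e.
  by apply: triangle_freeN va _; rewrite // sedge_sym.
have ncd' : ~~ (v -- c && v -- d).
  by apply/negP=> /andP[vc]; apply/negP; apply: triangle_freeN vc cd.
have memN w : v -- w -> w \in [:: a; c; d].
  move=> vw; have := cycle5_edge tf Ff C vw; rewrite (negbTE vC) /= !inE.
  case/or4P=> [/eqP->|/eqP wE|/eqP->|/orP[/eqP->|/eqP wE]];
  rewrite ?eqxx ?orbT //;
  by move: vw; rewrite wE ?(negbTE nvb) ?(negbTE nve).
have NE (A : {set G}) : (forall w, (w \in A) -> v -- w) ->
    (forall w, w \in [:: a; c; d] -> v -- w -> w \in A) -> neighborhood v = A.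
  move=> H1 H2; apply/setP=> w; rewrite inE; apply/idP/idP => [vw|/H1 //].
  by apply: H2 => //; apply: memN.
rewrite !in_cons in_nil orbF.
have [vc|nvc] := boolP (v -- c).
  have nvd : ~~ v -- d by move: ncd'; rewrite vc.
  rewrite (NE [set a; c]) ?eqxx ?orbT // => w.
    by rewrite !inE => /orP[]/eqP->.
  by rewrite !inE => /or3P[]/eqP->; rewrite ?eqxx ?orbT // (negbTE nvd).
have [vd|nvd] := boolP (v -- d).
  rewrite (NE [set a; d]) ?eqxx ?orbT // => w.
    by rewrite !inE => /orP[]/eqP->.
  by rewrite !inE => /or3P[]/eqP->; rewrite ?eqxx ?orbT // (negbTE nvc).
rewrite (NE [set a]) ?eqxx // => w; first by rewrite inE => /eqP->.
by rewrite !inE => /or3P[]/eqP->; rewrite ?eqxx // ?(negbTE nvc) ?(negbTE nvd).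
Qed.

Lemma centered_cycle5_in_D3_plus_isolated (G : sgraph) (a b c d e : G) :
    triangle_free G -> F_config_free G -> centered_cycle5 a b c d e ->
  in_D3_plus_isolated G.
Proof.
(* [S] is the set of non-isolated vertices; it contains the cycle, and inside it no vertex becomes
   isolated. *)
move=> tf Ff [C cen]; pose S := [set x : G | [exists y, x -- y]].
have inS x y : x -- y -> x \in S.
  by move=> xy; rewrite inE; apply/existsP; exists y.
exists S; split; last first.
  move=> x; rewrite inE negb_exists => /forallP nx; apply/setP=> y.
  by rewrite !inE (negbTE (nx y)).
case/and5P: (C) => ab bc cd de ea.
pose a' : induced S := Sub a (inS _ _ ab).
pose b' : induced S := Sub b (inS _ _ bc).
pose c' : induced S := Sub c (inS _ _ cd).
pose d' : induced S := Sub d (inS _ _ de).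
pose e' : induced S := Sub e (inS _ _ ea).
apply: (@centered_cycle5_in_D3 _ a' b' c' d' e').
- exact: induced_triangle_free.
- exact: induced_F_config_free.
- split; first exact: C.
  by move=> v u vC vu; apply: (cen _ (val u)).
move=> x; have := valP x; rewrite inE => /existsP[y xy].
have yS : y \in S by apply: (inS _ (val x)); rewrite sedge_sym.
by exists (Sub y yS).
Qed.

(* An edgeless graph contains neither K_3 nor any F_i but has omega <= 1, so
   the equivalence with "1-HNG and omega = 2" is asserted for graphs with at
   least one edge. K_{2, n-2} makes sense for 2 <= n; for n < 2 the truncated
   n - 2 is 0. *)
Theorem theorem5p5 (n : nat) (G : sgraph) (hn : #|G| = n) :
  ((exists x y : G, x -- y) -> (HNG1 G /\ omega G = 2 <-> K3_F_free G)) /\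
  (K3_F_free G <->
     [\/ is_subgraph G (complete_bipartite 2 (n - 2)),
         exists m : nat, 0 < m < n /\ is_subgraph G (double_star m (n - m))
       | in_D3_plus_isolated G]).
Proof.
split.
  case=> x [y xy]; have [om_tf tf_om] := omega_eq2P xy.
  split=> [[hng /om_tf tf]|/K3_F_freeP[tf Ff]].
    by apply/K3_F_freeP; split=> //; apply: HNG1_F_config_free.
  split; last exact: tf_om.
  move=> S; apply: chi_theta_ge.
    exact: induced_triangle_free.
  exact: induced_F_config_free.
split=> [/K3_F_freeP[tf Ff]|].
  have [[T [T2 cT]]|[a [b [c [d [e C]]]]]] := cover2_or_centered_cycle5 tf Ff.
    have [H|H] := cover2_subgraph hn tf cT T2; [exact: Or31 | exact: Or32].
  by apply: Or33; apply: centered_cycle5_in_D3_plus_isolated C.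
case=> [|[m [_]]|].
- exact: subgraph_complete_bipartite2.
- exact: subgraph_double_star.
- exact: in_D3_plus_isolated_K3_F_free.
Qed.
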